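(* For all integers $n, m$ with $0\le m\le n$, $$C\left(K_n^{-K_m}\right) = k(n+1,m+1).$$
   Context: All graphs are finite and simple. A graph composition of a graph $G$ is a partition of the vertex set $V(G)$ into nonempty blocks such that each block induces a connected subgraph of $G$; these blocks (with their induced subgraphs) are called the components of the composition. The composition number $C(G)$ is the number of graph compositions of $G$; for the graph with no vertices, $C=1$ (the empty partition). $K_n$ denotes the complete graph on $n$ vertices ($K_0$ is the graph with no vertices). For $0\le m\le n$, $K_n^{-K_m}$ denotes the graph on $n$ vertices obtained from $K_n$ by choosing $m$ of its vertices and deleting all edges joining two of the chosen vertices (well defined up to isomorphism). If $G$ is a labelled graph with $V(G)=\{1,2,\dots,n\}$, $n\ge 1$, then $v\in V(G)$ is the minimax vertex of a graph composition of $G$ if $v$ is the smallest element of the set of all maximum labels of the components of the composition, i.e. $v=\min_{B}\max B$ with $B$ ranging over the blocks. For $1\le m\le n$, $k(n,m)$ denotes the number of graph compositions of $K_n$ (with vertex set $\{1,\dots,n\}$) whose minimax vertex is $m$; equivalently, the number of set partitions of $\{1,\dots,n\}$ for which the minimum of the block maxima equals $m$. *)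

(* Defs.v *)
From mathcomp Require Import all_boot.

Set Implicit Arguments.
Unset Strict Implicit.
Unset Printing Implicit Defensive.

(* Finite simple graphs. *)
Record sgraph := SGraph {
  vertex :> finType;
  adj : rel vertex;
  adj_sym : symmetric adj;
  adj_irr : irreflexive adj }.

Section Induced.
Variables (G : sgraph) (B : {set G}).

Definition induced_adj : rel {x : G | x \in B} :=
  [rel x y | adj (val x) (val y)].

Lemma induced_adj_sym : symmetric induced_adj.
Proof. by move=> x y; apply: adj_sym. Qed.

Lemma induced_adj_irr : irreflexive induced_adj.
Proof. by move=> x; apply: adj_irr. Qed.

Definition induced : sgraph := SGraph induced_adj_sym induced_adj_irr.
End Induced.

(* The empty graph counts as connected here; this is harmless below, since
   [partition] already excludes empty blocks. *)
Definition connected (G : sgraph) : bool :=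
  [forall x : G, forall y : G, connect (@adj G) x y].

Definition composition (G : sgraph) (P : {set {set G}}) : bool :=
  partition P [set: G] && [forall B in P, connected (induced B)].

Definition composition_number (G : sgraph) : nat :=
  #|[set P : {set {set G}} | composition P]|.

Section Complete.
Variable n : nat.

Definition complete_adj : rel 'I_n := [rel x y | x != y].

Lemma complete_adj_sym : symmetric complete_adj.
Proof. by move=> x y; rewrite /complete_adj /= eq_sym. Qed.

Lemma complete_adj_irr : irreflexive complete_adj.
Proof. by move=> x; rewrite /complete_adj /= eqxx. Qed.

Definition complete : sgraph := SGraph complete_adj_sym complete_adj_irr.
End Complete.

Section DeleteInside.
Variables (G : sgraph) (S : {set G}).

Definition delete_inside_adj : rel G :=
  [rel x y | adj x y && ~~ ((x \in S) && (y \in S))].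

Lemma delete_inside_adj_sym : symmetric delete_inside_adj.
Proof. by move=> x y; rewrite /delete_inside_adj /= adj_sym [(x \in S) && _]andbC. Qed.

Lemma delete_inside_adj_irr : irreflexive delete_inside_adj.
Proof. by move=> x; rewrite /delete_inside_adj /= adj_irr. Qed.

(* [G] with every edge joining two vertices of [S] removed.  For
   [S : {set complete n}] with [#|S| = m] this is K_n^{-K_m}. *)
Definition delete_inside : sgraph :=
  SGraph delete_inside_adj_sym delete_inside_adj_irr.
End DeleteInside.

(* The vertices 0, ..., n-1 of ['I_n] carry the labels 1, ..., n. *)
Definition label n (x : 'I_n) : nat := x.+1.

Definition max_label n (B : {set 'I_n}) : nat := \max_(x in B) label x.

(* [v] is the label of the minimax vertex of [P]: the least element of the set
   of all maximum labels of the blocks. *)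
Definition is_minimax n (P : {set {set 'I_n}}) (v : nat) : bool :=
  [exists B in P, max_label B == v] && [forall B in P, v <= max_label B].

Definition minimax_number (n m : nat) : nat :=
  #|[set P : {set {set complete n}} | composition P && is_minimax P m]|.

(* Main.v *)
Require Import Defs.
From mathcomp Require Import all_boot.

Set Implicit Arguments.
Unset Strict Implicit.
Unset Printing Implicit Defensive.

(** A block of a composition of K_n^{-K_m} either meets the complement of the
    deleted clique [S], and is then automatically connected, or lies inside
    the independent set [S], and is then a single vertex.  So the composition
    amounts to its blocks that meet the complement of [S]: the vertices that
    they leave uncovered all lie in [S] and must be singletons.

    In a partition of n+1 labels with minimax vertex m+1, the block that
    contains m+1 has no larger label, and every other block has one.  So the
    partition amounts to its blocks that meet the labels above m+1: the
    uncovered labels, among which is m+1, must together form one block.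

    Relabel [S] by 1, ..., m and its complement by m+2, ..., n+1.  Both
    problems now ask for the same thing: a family of disjoint sets of labels
    other than m+1, each meeting the set of labels above m+1, and together
    covering that set.  The predicate [core] describes such families.  The
    common part of the two arguments is [card_partition_core]: whenever the
    blocks that miss a set [Y] are determined by their union, partitions are
    counted by the families of their blocks that meet [Y].
    [card_partition_singletons] and [card_partition_block] are its two
    instances, and [card_core_imset] transports [core] along the
    relabelling. *)

(** * Partitions determined by their blocks that meet a given set *)

Lemma eq_card_can_in (T1 T2 : finType) (A : {set T1}) (B : {set T2})
    (f : T1 -> T2) (g : T2 -> T1) :
  {in A, forall x, f x \in B} -> {in B, forall y, g y \in A} ->
  {in A, cancel f g} -> {in B, cancel g f} -> #|A| = #|B|.
Proof.
move=> fAB gBA fK gK; apply/eqP; rewrite eqn_leq.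
rewrite -{1}(card_in_imset (can_in_inj fK)) -{2}(card_in_imset (can_in_inj gK)).
by apply/andP; split; apply/subset_leq_card/subsetP => _ /imsetP[x Ax ->]; auto.
Qed.

Section Families.
Variable T : finType.
Implicit Types (B D U Y : {set T}) (P Q F : {set {set T}}).

Definition inner Y P := [set B in P | [disjoint B & Y]].
Definition outer Y P := [set B in P | ~~ [disjoint B & Y]].

(** The vertices outside [D] are those forced to stay uncovered: none for
    compositions, and the minimax vertex alone in the other problem. *)
Definition core D Y Q :=
  [&& trivIset Q, cover Q \subset D, Y \subset cover Q
    & [forall B in Q, ~~ [disjoint B & Y]]].

Lemma inner_outer Y P : outer Y P :|: inner Y P = P.
Proof. by apply/setP => B; rewrite !inE -andb_orr orNb andbT. Qed.

Lemma cover_inner_disjoint Y P : [disjoint cover (inner Y P) & Y].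
Proof.
rewrite -setI_eq0; apply/set0Pn => -[x /setIP[/bigcupP[B]]].
by rewrite inE => /andP[_ /disjointFr disBY] /disBY ->.
Qed.

Lemma coverU P Q : cover (P :|: Q) = cover P :|: cover Q.
Proof. exact: bigcup_setU. Qed.

Lemma trivIset_mem_eq P A B x :
  trivIset P -> A \in P -> B \in P -> x \in A -> x \in B -> A = B.
Proof.
move=> tP PA PB Ax Bx.
by rewrite -(def_pblock tP PA Ax) (def_pblock tP PB Bx).
Qed.

Lemma cover_outer Y P :
  partition P [set: T] -> cover (outer Y P) = ~: cover (inner Y P).
Proof.
move=> /and3P[/eqP covP tP _]; apply/setP => x; rewrite inE.
have: x \in cover P by rewrite covP.
rewrite -{1}(inner_outer Y P) coverU inE.
have [/bigcupP[B + Bx] _|_ /= ->] := boolP (x \in cover (outer Y P)) => //.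
rewrite inE => /andP[PB mB]; apply/esym/bigcupP => -[C].
rewrite inE => /andP[PC mC] Cx.
by rewrite (trivIset_mem_eq tP PB PC Bx Cx) mC in mB.
Qed.

Lemma partition_unionC P Q U :
  trivIset Q -> set0 \notin Q -> U = ~: cover Q -> partition P U ->
  partition (Q :|: P) [set: T].
Proof.
move=> tQ Q0 -> /and3P[/eqP covP tP P0].
rewrite /partition coverU covP setUCr eqxx inE (negPf Q0) (negPf P0) andbT.
by apply: trivIsetU => //; rewrite covP disjoints_subset setCK.
Qed.

(** The function [fill] is the rule that partitions the part left uncovered by
    the blocks meeting [Y].  Removing the blocks that miss [Y] and applying
    [fill] to what is left uncovered are inverse bijections. *)
Lemma card_partition_core D Y (fill : {set T} -> {set {set T}}) :
  (forall U, ~: D \subset U -> [disjoint U & Y] -> partition (fill U) U) ->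
  #|[set P | [&& partition P [set: T], ~: D \subset cover (inner Y P)
               & inner Y P == fill (cover (inner Y P))]]|
  = #|[set Q | core D Y Q]|.
Proof.
move=> fillP.
pose glue Q := Q :|: fill (~: cover Q).
have coreP Q : core D Y Q -> [/\ partition (fill (~: cover Q)) (~: cover Q),
    inner Y (glue Q) = fill (~: cover Q) & outer Y (glue Q) = Q].
  case/and4P=> tQ QD YQ /forall_inP meetQ.
  have pQ : partition (fill (~: cover Q)) (~: cover Q).
    apply: fillP; first by rewrite setCS.
    by rewrite disjoint_sym disjoints_subset setCK.
  have disQ B : B \in fill (~: cover Q) -> [disjoint B & Y].
    case/and3P: pQ => /eqP covQ _ _ fB.
    rewrite disjoints_subset; apply: (@subset_trans _ _ (~: cover Q)).
      by rewrite -{1}covQ; exact: bigcup_sup.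
    by rewrite setCS.
  split=> //; apply/setP => B; rewrite !inE andb_orl.
    have [/disQ disB|_] := boolP (B \in fill _); first by rewrite disB orbT.
    by rewrite orbF; apply/andP => -[/meetQ/negP].
  case QB: (B \in Q); first by rewrite meetQ.
  by case fB: (_ \in _) => //=; rewrite disQ.
apply: (@eq_card_can_in _ _ _ _ (outer Y) glue) => [P|Q|P|Q]; rewrite !inE.
- case/and3P=> pP DP _; have [/eqP covP tP _] := and3P pP.
  apply/and4P; split.
  + by apply: trivIsetS tP; apply/subsetP => B; rewrite inE => /andP[].
  + by rewrite cover_outer // -setCS setCK.
  + by rewrite cover_outer // -disjoints_subset disjoint_sym cover_inner_disjoint.
  + by apply/forall_inP => B; rewrite inE => /andP[].
- move=> cQ; have [pF -> _] := coreP _ cQ.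
  case/and4P: cQ => tQ QD YQ /forall_inP meetQ.
  have [/eqP covF _ _] := and3P pF.
  rewrite covF eqxx setCS QD !andbT.
  apply: partition_unionC pF => //; apply/negP => /meetQ.
  by rewrite disjoints_subset sub0set.
- case/and3P=> pP _ /eqP innP.
  by rewrite /glue cover_outer // setCK -innP inner_outer.
- by case/coreP.
Qed.

Lemma partition_singletons U : partition [set [set x] | x in U] U.
Proof.
apply/and3P; split.
- apply/eqP/setP => x; apply/bigcupP/idP => [[_ /imsetP[y Uy ->]]|Ux].
    by move/set1P->.
  by exists [set x]; [apply: imset_f | apply: set11].
- apply/trivIsetP => _ _ /imsetP[x _ ->] /imsetP[y _ ->] xy.
  by rewrite disjoints1 inE; apply: contra xy => /eqP->.
- by apply/imsetP => -[x _ /setP/(_ x)]; rewrite !inE eqxx.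
Qed.

Lemma singletonsE F :
  (F == [set [set x] | x in cover F]) = [forall B in F, #|B| == 1].
Proof.
apply/eqP/forall_inP => [-> _ /imsetP[x _ ->]|F1]; first by rewrite cards1.
apply/setP => B; apply/idP/imsetP => [FB|[x /bigcupP[C FC Cx] ->]].
  have /cards1P[x Bx] := F1 B FB.
  by exists x => //; apply/bigcupP; exists B => //; rewrite Bx set11.
by have /cards1P[y Cy] := F1 C FC; move: Cx FC; rewrite Cy => /set1P->.
Qed.

Lemma partition_set1 U : U != set0 -> partition [set U] U.
Proof.
move=> U0; rewrite /partition /cover big_set1 eqxx inE eq_sym U0 andbT /=.
by apply/trivIsetP => A B /set1P-> /set1P->; rewrite eqxx.
Qed.

(** When the blocks missing [Y] are merged into a single block containing
    [x0], missing [Y] singles out the block of [x0]; conversely only one block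
    of a partition can contain [x0]. *)
Lemma inner_blockE Y P x0 : partition P [set: T] ->
  (x0 \in cover (inner Y P)) && (inner Y P == [set cover (inner Y P)])
  = [forall B in P, [disjoint B & Y] == (x0 \in B)].
Proof.
case/and3P=> /eqP covP tP _.
apply/andP/forall_inP => [[x0U /eqP innP] B PB|blockP].
  have: cover (inner Y P) \in inner Y P by rewrite {2}innP set11.
  rewrite inE => /andP[PU disU].
  apply/eqP; apply/idP/idP => [disB|x0B].
    have: B \in inner Y P by rewrite inE PB.
    by rewrite innP => /set1P->.
  by rewrite (trivIset_mem_eq tP PB PU x0B x0U).
have /bigcupP[B0 PB0 B0x0]: x0 \in cover P by rewrite covP.
have -> : inner Y P = [set B0].
  apply/setP => B; rewrite !inE; apply/andP/eqP => [[PB]|->].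
    rewrite (eqP (blockP _ PB)) => Bx0.
    exact: trivIset_mem_eq tP PB PB0 Bx0 B0x0.
  by rewrite (eqP (blockP _ PB0)).
by rewrite /cover big_set1.
Qed.

Lemma card_partition_singletons Y :
  #|[set P | partition P [set: T]
             && [forall B in P, [disjoint B & Y] ==> (#|B| == 1)]]|
  = #|[set Q | core [set: T] Y Q]|.
Proof.
rewrite -(@card_partition_core _ _ (fun U => [set [set x] | x in U])); last first.
  by move=> U _ _; apply: partition_singletons.
apply: eq_card => P; rewrite !inE setCT sub0set singletonsE; congr andb.
by apply: eq_forallb => B; rewrite inE; case: (B \in P).
Qed.

Lemma card_partition_block Y x0 :
  #|[set P | partition P [set: T]
             && [forall B in P, [disjoint B & Y] == (x0 \in B)]]|
  = #|[set Q | core [set~ x0] Y Q]|.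
Proof.
rewrite -(@card_partition_core _ _ set1); last first.
  move=> U; rewrite setCK sub1set => x0U _; apply: partition_set1.
  by apply/set0Pn; exists x0.
apply: eq_card => P; rewrite !inE setCK sub1set.
by case pP: (partition _ _) => //=; rewrite inner_blockE.
Qed.

End Families.

(** * Transport along an injection *)

Section Transport.
Variables (T W : finType) (f : T -> W).
Hypothesis f_inj : injective f.

Let img (Q : {set {set T}}) := [set f @: (B : {set T}) | B in Q].

Lemma cover_image_family Q : cover (img Q) = f @: cover Q.
Proof.
rewrite /cover /img big_imset /=; last by move=> A B _ _; apply: imset_inj.
apply/setP => y; apply/bigcupP/imsetP => [[B QB /imsetP[x Bx ->]]|].
  by exists x => //; apply/bigcupP; exists B.
by case=> x /bigcupP[B QB Bx] ->; exists B => //; apply: imset_f.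
Qed.

Lemma disjoint_imset (A B : {set T}) :
  [disjoint f @: A & f @: B] = [disjoint A & B].
Proof. by rewrite -!setI_eq0 -imsetI ?imset_eq0 //; move=> x y _ _; apply: f_inj. Qed.

Lemma trivIset_image_family Q : trivIset (img Q) = trivIset Q.
Proof.
apply/trivIsetP/trivIsetP => tQ.
  move=> A B QA QB AB; rewrite -disjoint_imset.
  by apply: tQ; rewrite ?imset_f // (inj_eq (imset_inj f_inj)).
move=> _ _ /imsetP[A QA ->] /imsetP[B QB ->].
by rewrite (inj_eq (imset_inj f_inj)) disjoint_imset; apply: tQ.
Qed.

Lemma subset_imset_inj (A B : {set T}) : (f @: A \subset f @: B) = (A \subset B).
Proof.
apply/idP/idP; last exact: imsetS.
by move=> sAB; apply/subsetP => x /(imset_f f) /(subsetP sAB); rewrite mem_imset.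
Qed.

Lemma core_imset (D Y : {set T}) Q : core (f @: D) (f @: Y) (img Q) = core D Y Q.
Proof.
rewrite /core trivIset_image_family cover_image_family !subset_imset_inj.
congr [&& _, _, _ & _]; apply/forall_inP/forall_inP => meetQ.
  by move=> B QB; rewrite -disjoint_imset; apply: meetQ; apply: imset_f.
by move=> _ /imsetP[B QB ->]; rewrite disjoint_imset; apply: meetQ.
Qed.

(** A [core] family on the image has all its members inside the range of [f],
    so it is the image of the family of their preimages. *)
Lemma card_core_imset (D Y : {set T}) :
  #|[set Q | core (f @: D) (f @: Y) Q]| = #|[set Q | core D Y Q]|.
Proof.
rewrite -[RHS](card_imset _ (imset_inj (imset_inj f_inj))).
apply: eq_card => Q; rewrite !inE.
apply/idP/imsetP => [cQ|[Q' + ->]]; last by rewrite inE core_imset.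
have defQ : Q = img [set f @^-1: (B : {set W}) | B in Q].
  rewrite /img -imset_comp -[LHS]imset_id; apply: eq_in_imset => B QB /=.
  apply/setP => y; apply/idP/imsetP => [By|[x + ->]]; last by rewrite inE.
  have /imsetP[x _ yx] : y \in f @: D.
    case/and4P: cQ => _ /subsetP sQD _ _.
    by apply: sQD; apply/bigcupP; exists B.
  by exists x; rewrite // inE -yx.
exists [set f @^-1: (B : {set W}) | B in Q] => //.
by rewrite inE -core_imset -defQ.
Qed.

End Transport.

(** * Connected blocks *)

Lemma connected_complete n (B : {set complete n}) : connected (induced B).
Proof.
apply/forallP => x; apply/forallP => y.
have [->|xy] := eqVneq x y; first exact: connect0.
exact: connect1.
Qed.

(** A vertex outside [S] keeps all its edges, so it connects any block that
    contains it; inside [S] there are no edges at all. *)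
Lemma connected_delete_inside n (S B : {set complete n}) : B != set0 ->
  @connected (@induced (delete_inside S) B) = (B \subset S) ==> (#|B| == 1).
Proof.
case/set0Pn=> b Bb.
apply/idP/implyP => [conB sBS|BS].
  apply/eqP/eqP/cards1P; exists b; apply/setP => c; rewrite inE.
  apply/idP/eqP => [Bc|-> //].
  have /forallP/(_ (Sub b Bb))/forallP/(_ (Sub c Bc)) := conB.
  case/connectP=> -[|d p] /=; first by move=> _ /(congr1 val).
  case/andP=> /andP[_]; rewrite (subsetP sBS _ Bb).
  by rewrite (subsetP sBS _ (valP d)).
apply/forallP => x; apply/forallP => y.
have [/BS/cards1P[c Bc]|/subsetPn[z Bz Sz]] := boolP (B \subset S).
  suff -> : x = y by apply: connect0.
  apply: val_inj.
  have eqc v : v \in B -> v = c by rewrite Bc => /set1P.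
  by rewrite (eqc _ (valP x)) (eqc _ (valP y)).
pose u : {v : delete_inside S | v \in B} := Sub z Bz.
have adjz w : connect (@induced_adj (delete_inside S) B) w u.
  have [->|wu] := eqVneq w u; first exact: connect0.
  apply: connect1; apply/andP; split; last by apply/negP => /andP[_]; apply/negP.
  by apply: contra wu => /eqP/val_inj->.
apply: (@connect_trans _ _ u); first exact: adjz.
by rewrite (sym_connect_sym (@induced_adj_sym (delete_inside S) B)).
Qed.

Lemma composition_completeE n (P : {set {set complete n}}) :
  composition P = partition P [set: complete n].
Proof.
rewrite /composition; case: partition => //=.
by apply/forall_inP => B _; apply: connected_complete.
Qed.

Lemma composition_delete_insideE n (S : {set complete n})
    (P : {set {set complete n}}) :
  @composition (delete_inside S) P
  = partition P [set: complete n]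
    && [forall B in P, (B \subset S) ==> (#|B| == 1)].
Proof.
rewrite /composition; case pP: (partition _ _) => //=.
apply: eq_forallb_in => B PB; apply: connected_delete_inside.
by apply: contraTneq PB => ->; case/and3P: pP.
Qed.

(** * The minimax vertex *)

(** A block misses the labels above that of [x0] exactly when its maximum is
    at most that label.  If [x0] is the minimax vertex, such a block attains
    the least maximum, which is therefore its own element [x0]. *)
Lemma is_minimaxE n (P : {set {set 'I_n}}) (x0 : 'I_n) :
  partition P [set: 'I_n] ->
  is_minimax P (label x0)
  = [forall B in P, [disjoint B & [set i : 'I_n | x0 < i]] == (x0 \in B)].
Proof.
case/and3P=> /eqP covP tP P0.
have disE (B : {set 'I_n}) :
    [disjoint B & [set i : 'I_n | x0 < i]] = (max_label B <= label x0).
  rewrite disjoints_subset; apply/subsetP/bigmax_leqP => leB i Bi.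
    by have := leB i Bi; rewrite !inE -leqNgt.
  by have := leB i Bi; rewrite !inE -leqNgt.
have maxE (B : {set 'I_n}) : x0 \in B -> label x0 <= max_label B.
  by move=> Bx0; apply: (@leq_bigmax_cond _ _ (@label n)).
have memE (B : {set 'I_n}) : B \in P -> max_label B = label x0 -> x0 \in B.
  move=> PB maxB; have [|i Bi] := @eq_bigmax_cond _ (mem B) (@label n).
    by rewrite card_gt0; apply: contraTneq PB => ->.
  rewrite -/(max_label B) maxB => -[x0i].
  by rewrite (ord_inj x0i).
apply/idP/forall_inP => [/andP[/exists_inP[B0 PB0 /eqP max0] /forall_inP minP] B PB|blockP].
  rewrite disE; apply/eqP; apply/idP/idP => [leB|Bx0].
    by apply: memE => //; apply/eqP; rewrite eqn_leq leB minP.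
  by rewrite (trivIset_mem_eq tP PB PB0 Bx0 (memE _ PB0 max0)) max0.
have /bigcupP[B0 PB0 B0x0]: x0 \in cover P by rewrite covP inE.
apply/andP; split.
  apply/exists_inP; exists B0 => //.
  by rewrite eqn_leq maxE // -disE (eqP (blockP _ PB0)) B0x0.
apply/forall_inP => B PB; have [Bx0|] := boolP (x0 \in B); first exact: maxE.
by rewrite -(eqP (blockP _ PB)) disE -ltnNge => /ltnW.
Qed.

(** * The relabelling *)

(** List the elements of [S] first, then the others; sending each to its
    position in the list and skipping the value [x0], which is the size of
    [S], places exactly the complement of [S] above [x0]. *)
Lemma exists_relabel n (S : {set 'I_n}) (x0 : 'I_n.+1) : #|S| = x0 ->
  exists f : 'I_n -> 'I_n.+1, [/\ injective f, f @: [set: 'I_n] = [set~ x0]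
    & f @: (~: S) = [set i : 'I_n.+1 | x0 < i]].
Proof.
move=> cardS; pose s := enum S ++ enum (~: S).
have s_mem x : x \in s by rewrite mem_cat !mem_enum inE orbN.
have s_size : size s = n by rewrite size_cat -!cardE cardsC card_ord.
have s_lt x : index x s < n by rewrite -[X in _ < X]s_size index_mem.
pose f x := lift x0 (Ordinal (s_lt x)).
have f_inj : injective f.
  move=> x y /lift_inj/(congr1 val)/= eq_xy.
  by rewrite -(nth_index x (s_mem x)) eq_xy nth_index.
have f_im : f @: [set: 'I_n] = [set~ x0].
  apply/eqP; rewrite eqEcard card_imset // cardsT card_ord.
  rewrite cardsC1 card_ord leqnn andbT.
  by apply/subsetP => _ /imsetP[x _ ->]; rewrite !inE eq_sym neq_lift.
have f_gt x : (x0 < f x) = (x \notin S).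
  rewrite /= /bump index_cat mem_enum -cardS cardE; case: ifP => Sx /=.
    have iS : index x (enum S) < size (enum S) by rewrite index_mem mem_enum.
    by rewrite (leqNgt (size _)) iS add0n ltnNge ltnW.
  by rewrite leq_addr add1n ltnS leq_addr.
exists f; split=> //; apply/setP => i; rewrite inE.
apply/imsetP/idP => [[x + ->]|lt_i]; first by rewrite inE f_gt.
have /imsetP[x _ ix] : i \in f @: [set: 'I_n].
  by rewrite f_im !inE; apply: contraTneq lt_i => ->; rewrite ltnn.
by exists x; rewrite // inE -f_gt -ix.
Qed.

Theorem theorem2 (n m : nat) (le_mn : m <= n)
    (S : {set complete n}) (card_S : #|S| = m) :
  composition_number (delete_inside S) = minimax_number n.+1 m.+1.
Proof.
pose x0 : 'I_n.+1 := Ordinal (le_mn : m < n.+1).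
have [f [f_inj f_im f_gt]] := @exists_relabel n S x0 card_S.
transitivity #|[set Q | core [set: 'I_n] (~: S) Q]|.
  rewrite -card_partition_singletons; apply: eq_card => P.
  rewrite !inE composition_delete_insideE; congr andb.
  by apply: eq_forallb => B; rewrite disjoints_subset setCK.
rewrite -(card_core_imset f_inj) f_im f_gt -card_partition_block.
apply: eq_card => P; rewrite !inE composition_completeE.
by case pP: (partition _ _) => //=; rewrite -is_minimaxE.
Qed.
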